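(* Let $X,E,Y,d,\mathcal{N},\hat{\mathcal{N}},|\cdot|,\alpha,\beta,\gamma$ be as in the context. Let $\lambda_n>0$ and $a_n>0$, $n\in\mathbb{N}=\{0,1,2,\dots\}$, satisfy $$a_n\leq a_{n-1}\ \text{for any }n\geq 1,\qquad \lim_n a_n=0,\qquad \limsup_n\frac{2^{\beta n}}{\lambda_na_n}=0.$$ Let $\delta_0=\inf\{d(\hat{\mathcal{N}},\mathcal{N}(\sigma)):\ \sigma\in E\}$ and assume that there exists a solution $\hat{\sigma}$ of $$\min\{|\sigma|:\ \sigma\in E\text{ and }d(\hat{\mathcal{N}},\mathcal{N}(\sigma))=\delta_0\}<+\infty. \qquad (\ast)$$ Let $\hat{E}$ be the set of solutions of $(\ast)$. Let $\{\sigma_n\}_{n\in\mathbb{N}}$ be any sequence such that $\sigma_0$ is a minimizer of $$\min\left\{\lambda_0[d(\hat{\mathcal{N}},\mathcal{N}(\sigma))^{\alpha}+a_0|\sigma|^{\gamma}]+|\sigma|^{\beta}:\ \sigma\in E\right\}$$ and, for $n\geq 1$, $\sigma_n$ is a minimizer of $$\min\left\{\lambda_n[d(\hat{\mathcal{N}},\mathcal{N}(\tilde{\sigma}_{n-1}+\sigma))^{\alpha}+a_n|\tilde{\sigma}_{n-1}+\sigma|^{\gamma}]+|\sigma|^{\beta}:\ \tilde{\sigma}_{n-1}+\sigma\in E\right\},$$ where $\tilde{\sigma}_{n}=\sum_{j=0}^{n}\sigma_j$. Then $\tilde{\sigma}_n$ converges in $X$, up to a subsequence, to some $\tilde{\sigma}_{\infty}$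 which is a (possibly different from $\hat{\sigma}$) solution of $(\ast)$, that is, $\tilde{\sigma}_\infty\in E$, $d(\hat{\mathcal{N}},\mathcal{N}(\tilde{\sigma}_{\infty}))=\delta_0$ and $|\tilde{\sigma}_{\infty}|=|\hat{\sigma}|$. Furthermore, $$\lim_n|\tilde{\sigma}_n|=|\hat{\sigma}|\qquad\text{and}\qquad \lim_n\mathrm{dist}(\tilde{\sigma}_n,\hat{E})=0,$$ where $\mathrm{dist}(\sigma,\hat{E})=\inf\{\|\sigma-\sigma'\|:\ \sigma'\in\hat{E}\}$ for any $\sigma\in X$.
   Context: $X$ is a real Banach space with norm $\|\cdot\|$; $E$ is a closed nonempty subset of $X$; $Y$ is a metric space with distance $d$; $\mathcal{N}:E\to Y$ is a (possibly nonlinear) map and $\hat{\mathcal{N}}\in Y$, such that the function $E\ni\sigma\mapsto d(\hat{\mathcal{N}},\mathcal{N}(\sigma))$ is continuous with respect to the norm of $X$. There is a function $|\cdot|:X\to[0,+\infty]$ such that: 1) $|0|=0$ and $|-x|=|x|$ for any $x\in X$; 2) $|x+y|\leq|x|+|y|$ for any $x,y\in X$; 3) $\{x\in E:\ |x|<+\infty\}$ is dense in $E$; 4) $\{x\in X:\ |x|\leq b\}$ is relatively sequentially compact in $X$ for any $b\in\mathbb{R}$; 5) $|\cdot|$ is sequentially lower semicontinuous on $X$ with respect to norm convergence. $\alpha,\beta,\gamma$ are fixed positive constants. These assumptions guarantee that sequences $\{\sigma_n\}$ as in the claim exist (not necessarily unique). *)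

(* Defs.v *)
From HB Require Import structures.
From mathcomp Require Export all_boot all_order all_algebra.
From mathcomp Require Export all_classical all_reals all_analysis.

Set Implicit Arguments.
Unset Strict Implicit.
Unset Printing Implicit Defensive.

Export Order.TTheory GRing.Theory Num.Theory.
Export numFieldNormedType.Exports.

Local Open Scope classical_set_scope.
Local Open Scope ring_scope.

(* Points of [A] at which [f] attains its minimum over [A]; the minimum value
   may be [+oo]. *)
Definition argmin (R : realType) (T : Type) (f : T -> \bar R) (A : set T) :
    set T :=
  [set x | A x /\ forall y, A y -> (f x <= f y)%E].

(* The limit of the subsequence need not belong to [A]. *)
Definition rel_seq_compact (X : topologicalType) (A : set X) : Prop :=
  forall u : nat -> X, (forall n, A (u n)) ->
    exists2 phi : nat -> nat, increasing_seq phi &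
      exists x : X, u \o phi @ \oo --> x.

Definition seq_lower_semicontinuous (R : realType) (X : topologicalType)
    (f : X -> \bar R) : Prop :=
  forall (u : nat -> X) (x : X), u @ \oo --> x ->
    (f x <= limn_einf (f \o u))%E.

Definition dist_to_set (R : realType) (X : normedModType R) (x : X)
    (A : set X) : R :=
  inf [set `|x - y| | y in A].

Definition psum (X : zmodType) (sigma : nat -> X) (n : nat) : X :=
  \sum_(0 <= j < n.+1) sigma j.

(* Main.v *)
(** Write [T n] for the partial sums (with [T 0 = 0]) and [x] for [sigmahat].
    Testing the minimality of the [n]-th increment against [x - T n] gives
    [l (f (T n.+1) + a q^gamma) + t^beta <= l (f x + a h^gamma) + e^beta]
    with [q], [t], [h], [e] the values of [p] at [T n.+1], [sigma n], [x] and
    [x - T n].  If [q > h] then [t <= e], hence [p (x - T n.+1) <= 2 e]; if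
    [q <= h] then [p (x - T n.+1) <= 2 h].  So [e <= 2^n h], and dividing by
    [l a] bounds [q^gamma] by [h^gamma] plus a multiple of [2^(beta n)/(l a)],
    which tends to 0.  Compactness of sublevel sets and lower semicontinuity
    then identify all subsequential limits as elements of [Ehat]. *)

Require Import Defs.
From mathcomp Require Import ring lra.

Local Open Scope classical_set_scope.
Local Open Scope ring_scope.

Lemma increasing_seq_ge_id (phi : nat -> nat) :
  increasing_seq phi -> forall n, (n <= phi n)%N.
Proof.
move=> /increasing_seqP incr; elim=> // n IH.
exact: leq_ltn_trans IH (incr n).
Qed.

Lemma increasing_seq_cvg (phi : nat -> nat) :
  increasing_seq phi -> phi @ \oo --> \oo.
Proof.
move=> incr A [M _ MA]; exists M => // n /= Mn; apply: MA => /=.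
exact: leq_trans Mn (increasing_seq_ge_id _ incr n).
Qed.

(** If [u] left a neighbourhood of [l] infinitely often, the terms outside it would form a
    subsequence with no further subsequence tending to [l]. This turns compactness into convergence
    of a whole sequence. *)
Lemma cvg_sub_subseq (T : topologicalType) (u : nat -> T) (l : T) :
  (forall phi : nat -> nat, increasing_seq phi ->
    exists2 psi : nat -> nat, increasing_seq psi &
      u \o phi \o psi @ \oo --> l) ->
  u @ \oo --> l.
Proof.
move=> H A lA; apply: contrapT => nA.
have /choice[f fP] : forall M, exists n, (M <= n)%N /\ ~ A (u n).
  move=> M; apply: contrapT => nex; apply: nA; exists M => // n /= Mn.
  by apply: contrapT => nAn; apply: nex; exists n.
pose phi := fix phi n := if n is m.+1 then f (phi m).+1 else f 0%N.
have phiN n : ~ A (u (phi n)) by case: n => [|n]; exact: (fP _).2.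
have [|psi _ /(_ A lA)[M _ MA]] := H phi.
  by apply/increasing_seqP => n; exact: (fP (phi n).+1).1.
exact: (phiN (psi M)) (MA M (leqnn M)).
Qed.

Lemma limn_einf_gt_near (R : realType) (u : nat -> \bar R) (l : \bar R) :
  (l < limn_einf u)%E -> \forall n \near \oo, (l < u n)%E.
Proof.
rewrite limn_einf_lim (cvg_lim _ (@cvg_einfs_sup _ u))//.
move=> /ereal_sup_gt[_ [M _ <-] lM]; exists M => // n /= Mn.
by apply: (lt_le_trans lM); apply: ereal_inf_lbound; exists n.
Qed.

(** Strict monotonicity leaves a fixed positive gap between the [r]-th powers of [l] and [l + e],
    and [c n] eventually drops below it. It serves both exponents, [gamma] and [alpha]. *)
Lemma powR_near_ltD (R : realType) (r l : R) (u c : nat -> R) :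
  0 < r -> 0 <= l -> (forall n, 0 <= u n) ->
  (forall n, u n `^ r <= l `^ r + c n) -> c @ \oo --> (0 : R) ->
  forall e, 0 < e -> \forall n \near \oo, u n < l + e.
Proof.
move=> r0 l0 u0 uc c0 e e0.
have le0 : 0 <= l + e by lra.
have : 0 < (l + e) `^ r - l `^ r.
  by rewrite subr_gt0 gt0_ltr_powR// ltrDl.
move=> /(cvgr_lt _ c0) [M _ Mc]; exists M => // n /= /Mc /=.
rewrite ltrBrDl => /(le_lt_trans (uc n)); apply: contraTT; rewrite -!leNgt.
by move=> leu; rewrite ge0_ler_powR ?nnegrE ?(ltW r0).
Qed.

Lemma near_cvg_of_bounds (R : realType) (u : nat -> R) (l : R) :
  (forall e, 0 < e -> \forall n \near \oo, u n < l + e) ->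
  (forall e, 0 < e -> \forall n \near \oo, l - e < u n) ->
  u @ \oo --> l.
Proof.
move=> hi lo; apply/cvgrPdist_lt => e e0; near=> n.
have h1 : u n < l + e by near: n; exact: hi.
have h2 : l - e < u n by near: n; exact: lo.
by rewrite ltr_distl; lra.
Unshelve. all: end_near. Qed.

(** The competitor is the increment [x - T], which moves [T] to [x]; its cost is finite, hence so is
    that of the minimizer. *)
Lemma argmin_step (R : realType) (X : zmodType) (E : set X) (p : X -> \bar R)
    (f : X -> R) (l a beta gamma h e : R) (T s x : X) :
  0 < l -> 0 < a -> 0 < beta -> 0 < gamma ->
  (forall y, (0 <= p y)%E) -> (forall y, 0 <= f y) ->
  argmin (fun s => (l%:E * ((f (T + s)%R)%:E + a%:E * p (T + s)%R `^ gamma)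
                    + p s `^ beta)%E) [set s | E (T + s)] s ->
  E x -> p x = h%:E -> p (x - T) = e%:E ->
  exists q t, [/\ p (T + s) = q%:E, p s = t%:E &
    l * (f (T + s) + a * q `^ gamma) + t `^ beta
      <= l * (f x + a * h `^ gamma) + e `^ beta].
Proof.
move=> l0 a0 b0 g0 p0 f0 [Es /(_ (x - T))] /=.
rewrite addrC subrK => + Ex px pxT; rewrite px pxT => /(_ Ex).
rewrite !poweR_EFin -!(EFinM, EFinD).
have := p0 (T + s); have := p0 s.
case: (p s) => [t||] //; case: (p (T + s)) => [q||] // _ _.
- by rewrite !poweR_EFin -!(EFinM, EFinD) lee_fin => H; exists q, t.
(* In the remaining cases [p s] or [p (T + s)] is infinite; as weights and exponents are positive,
   the cost of [s] would be infinite too. *)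
- rewrite poweRyr ?gt_eqF// poweR_EFin gt0_muley ?lte_fin//.
  by rewrite addey// gt0_muley ?lte_fin// addye// leye_eq.
- rewrite poweRyr ?gt_eqF// poweR_EFin -!(EFinM, EFinD) addey//.
- rewrite !poweRyr ?gt_eqF// gt0_muley ?lte_fin//.
  by rewrite addey// gt0_muley ?lte_fin// addye// leye_eq.
Qed.

Lemma dist_iterates_le (R : realType) (X : zmodType) (E : set X)
    (p : X -> \bar R) (f : X -> R) (l a : nat -> R) (beta gamma h : R)
    (sigma : nat -> X) (x : X) :
  let T n := \sum_(0 <= j < n) sigma j in
  (forall n, 0 < l n) -> (forall n, 0 < a n) -> 0 < beta -> 0 < gamma ->
  (forall y, (0 <= p y)%E) -> (forall y, p (- y) = p y) ->
  (forall y z, (p (y + z)%R <= p y + p z)%E) -> (forall y, 0 <= f y) ->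
  (forall n, argmin (fun s =>
      ((l n)%:E * ((f (T n + s)%R)%:E + (a n)%:E * p (T n + s)%R `^ gamma)
       + p s `^ beta)%E) [set s | E (T n + s)] (sigma n)) ->
  E x -> p x = h%:E -> (forall y, E y -> f x <= f y) ->
  forall n, exists2 e, p (x - T n) = e%:E & 0 <= e <= 2 ^+ n * h.
Proof.
move=> T l0 a0 b0 g0 p0 pN pD f0 am Ex px fx.
have h0 : 0 <= h by rewrite -lee_fin -px.
elim=> [|n [e pe /andP[e0 en]]].
  by exists h; rewrite /T ?big_geq// ?subr0// expr0 mul1r h0 lexx.
have [q [t [pq pt H]]] := argmin_step _ _ _ _ _ _ _ _ _ _ _ _ _ _
  (l0 n) (a0 n) b0 g0 p0 f0 (am n) Ex px pe.
have TS : T n.+1 = T n + sigma n by rewrite /T big_nat_recr.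
have q0 : 0 <= q by rewrite -lee_fin -pq.
have t0 : 0 <= t by rewrite -lee_fin -pt.
suff : (p (x - T n.+1)%R <= (2 ^+ n.+1 * h)%:E)%E.
  have := p0 (x - T n.+1); case: (p _) => [e'||]//.
  by rewrite !lee_fin => e'0 e'n; exists e' => //; rewrite e'0.
(* For the case [q <= h], where the triangle inequality gives [h + q <= 2 * h], still to be compared
   with [2 ^+ n.+1 * h]. *)
have n1 : 1 <= 2 ^+ n :> R by rewrite exprn_ege1// ler1n.
have [qh|hq] := leP q h.
  apply: (le_trans (pD _ _)); rewrite pN TS pq px -EFinD lee_fin exprS.
  by nra.
(* Neither [f] nor [p] is larger at [x] than at [T n.+1], so [e < t] would make the increment
   [x - T n] strictly cheaper than [sigma n]. *)
have te : t <= e.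
  rewrite leNgt; apply/negP => et.
  have := gt0_ltr_powR b0 e0 t0 et; rewrite ltNge => /negP; apply.
  have hq' : h `^ gamma <= q `^ gamma by rewrite ge0_ler_powR ?(ltW g0)// ltW.
  have fq := fx _ (am n).1.
  rewrite -(lerD2l (l n * (f x + a n * h `^ gamma))); apply: le_trans H.
  rewrite lerD2r ler_wpM2l ?(ltW (l0 n))// lerD// ler_wpM2l// ltW//.
rewrite TS opprD addrA; apply: (le_trans (pD _ _)).
rewrite pN pe pt -EFinD lee_fin exprS; lra.
Qed.

Lemma argmin_iterates_le (R : realType) (X : zmodType) (E : set X)
    (p : X -> \bar R) (f : X -> R) (l a : nat -> R) (beta gamma h : R)
    (sigma : nat -> X) (x : X) :
  let T n := \sum_(0 <= j < n) sigma j in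
  let c n := h `^ gamma + 2 `^ (beta * n%:R) / (l n * a n) * h `^ beta in
  (forall n, 0 < l n) -> (forall n, 0 < a n) -> 0 < beta -> 0 < gamma ->
  (forall y, (0 <= p y)%E) -> (forall y, p (- y) = p y) ->
  (forall y z, (p (y + z)%R <= p y + p z)%E) -> (forall y, 0 <= f y) ->
  (forall n, argmin (fun s =>
      ((l n)%:E * ((f (T n + s)%R)%:E + (a n)%:E * p (T n + s)%R `^ gamma)
       + p s `^ beta)%E) [set s | E (T n + s)] (sigma n)) ->
  E x -> p x = h%:E -> (forall y, E y -> f x <= f y) ->
  forall n, exists q, [/\ p (T n.+1) = q%:E, q `^ gamma <= c n &
    f (T n.+1) <= f x + a n * c n].
Proof.
move=> T c l0 a0 b0 g0 p0 pN pD f0 am Ex px fx n.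
have [e pe /andP[e0 en]] := dist_iterates_le _ _ _ _ _ _ _ _ _ _ _ _
  l0 a0 b0 g0 p0 pN pD f0 am Ex px fx n.
have [q [t [pq pt H]]] := argmin_step _ _ _ _ _ _ _ _ _ _ _ _ _ _
  (l0 n) (a0 n) b0 g0 p0 f0 (am n) Ex px pe.
have TS : T n.+1 = T n + sigma n by rewrite /T big_nat_recr.
have h0 : 0 <= h by rewrite -lee_fin -px.
have fq := fx _ (am n).1.
(* The correction in [c n] is the bound [2 ^+ n * h] on [e], raised to [beta] and divided by
   [l n * a n]. *)
have eb : e `^ beta <= l n * a n * (c n - h `^ gamma).
  have -> : l n * a n * (c n - h `^ gamma) = (2 ^+ n * h) `^ beta.
    rewrite /c powRM ?exprn_ge0// -powR_mulrn// -powRrM (mulrC n%:R).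
    by field; rewrite !gt_eqF.
  by rewrite ge0_ler_powR ?nnegrE ?(ltW b0)// mulr_ge0// exprn_ge0.
have t0 : 0 <= t `^ beta by exact: powR_ge0.
have q0 : 0 <= q `^ gamma by exact: powR_ge0.
have {H} H : l n * (f (T n + sigma n) + a n * q `^ gamma)
    <= l n * (f x + a n * c n) by nra.
move: H; rewrite ler_pM2l// => H.
(* Dropping this nonnegative term from [H] bounds [f]; cancelling [f x] against the larger
   [f (T n + sigma n)] bounds [q]. *)
have aq : 0 <= a n * q `^ gamma by rewrite mulr_ge0// ltW.
exists q; rewrite TS; split=> //; last by lra.
by rewrite -(ler_pM2l (a0 n)); lra.
Qed.

Theorem theorem2p6 (R : realType) (X : completeNormedModType R) (E : set X)
    (Y : metricType R) (N : X -> Y) (Nhat : Y) (p : X -> \bar R)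
    (alpha beta gamma : R) (lambda a : nat -> R)
    (delta0 : R) (Ehat : set X) (sigmahat : X) (sigma : nat -> X) :
  closed E -> E !=set0 ->
  {within E, continuous (fun s : X => mdist Nhat (N s))} ->
  (forall x : X, (0 <= p x)%E) ->
  p 0 = 0%E -> (forall x : X, p (- x) = p x) ->
  (forall x y : X, (p (x + y)%R <= p x + p y)%E) ->
  E `<=` closure [set x | E x /\ (p x < +oo)%E] ->
  (forall b : R, rel_seq_compact [set x : X | (p x <= b%:E)%E]) ->
  seq_lower_semicontinuous p ->
  0 < alpha -> 0 < beta -> 0 < gamma ->
  (forall n, 0 < lambda n) -> (forall n, 0 < a n) ->
  (forall n, a n.+1 <= a n) ->
  a @ \oo --> (0 : R) ->
  limn_esup (fun n => (2 `^ (beta * n%:R) / (lambda n * a n))%:E) = 0%E ->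
  delta0 = inf [set mdist Nhat (N s) | s in E] ->
  Ehat = argmin p [set s | E s /\ mdist Nhat (N s) = delta0] ->
  Ehat sigmahat -> (p sigmahat < +oo)%E ->
  argmin (fun s : X =>
      ((lambda 0%N)%:E *
         ((mdist Nhat (N s) `^ alpha)%R%:E + (a 0%N)%:E * p s `^ gamma)
       + p s `^ beta)%E)
    E (sigma 0%N) ->
  (forall n : nat,
    argmin (fun s : X =>
        ((lambda n.+1)%:E *
           ((mdist Nhat (N (psum sigma n + s)%R) `^ alpha)%R%:E
            + (a n.+1)%:E * p (psum sigma n + s)%R `^ gamma)
         + p s `^ beta)%E)
      [set s | E (psum sigma n + s)] (sigma n.+1)) ->
  [/\ (exists2 phi : nat -> nat, increasing_seq phi &
        exists sigmainf : X,
          [/\ psum sigma \o phi @ \oo --> sigmainf,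
              Ehat sigmainf,
              E sigmainf,
              mdist Nhat (N sigmainf) = delta0 &
              p sigmainf = p sigmahat]),
      p \o psum sigma @ \oo --> p sigmahat &
      (fun n => dist_to_set (psum sigma n) Ehat) @ \oo --> (0 : R)].
Proof.
move=> cE E0 cD p0 p00 pN pD dE pcomp plsc al0 b0 g0 l0 a0 amono a_to0 limr.
move=> d0E EhatE sEhat ps_fin am0 amS.
pose D s := mdist Nhat (N s); pose T n := \sum_(0 <= j < n) sigma j.
have D0 s : 0 <= D s by exact: mdist_ge0.
have d0D s : E s -> delta0 <= D s.
  move=> Es; rewrite d0E; apply: ge_inf; last by exists s.
  by exists 0 => _ [y _ <-]; exact: mdist_ge0.
have [[Esh Dsh] shmin] : argmin p [set s | E s /\ D s = delta0] sigmahat.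
  by rewrite -EhatE.
have d00 : 0 <= delta0 by rewrite -Dsh.
have [h ph] : exists h, p sigmahat = h%:E.
  by have := p0 sigmahat; move: ps_fin; case: (p _) => // h _ _; exists h.
have h0 : 0 <= h by rewrite -lee_fin -ph.
(* Since [T 0 = 0], the initial problem takes the same form as the later ones. *)
have am n : argmin (fun s => ((lambda n)%:E *
    ((D (T n + s)%R `^ alpha)%R%:E + (a n)%:E * p (T n + s)%R `^ gamma)
    + p s `^ beta)%E) [set s | E (T n + s)] (sigma n).
  case: n => [|n]; last exact: amS.
  suff -> : T 0%N = 0.
    by case: am0 => Es mins; split=> [|y]; rewrite /= !add0r //; exact: mins.
  by rewrite /T big_geq.
have fsh y : E y -> D sigmahat `^ alpha <= D y `^ alpha.
  by move=> Ey; rewrite Dsh ge0_ler_powR ?nnegrE ?(ltW al0)// d0D.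
pose r n := 2 `^ (beta * n%:R) / (lambda n * a n).
(* The terms are nonnegative, so a zero upper limit forces convergence. *)
have r_to0 : r @ \oo --> (0 : R).
  have : EFin \o r @ \oo --> 0%:E.
    apply: limn_esup_le_cvg => [|n]; first by rewrite limr.
    by rewrite /= lee_fin divr_ge0 ?powR_ge0// mulr_ge0// ltW.
  by move/fine_cvgP => [].
pose c n := h `^ gamma + r n * h `^ beta.
have rh_to0 : (fun n => r n * h `^ beta) @ \oo --> (0 : R).
  by rewrite -(mul0r (h `^ beta)); exact: cvgMl.
have ac_to0 : (fun n => a n * c n) @ \oo --> (0 : R).
  rewrite -(mul0r (h `^ gamma + 0)).
  by apply: cvgM => //; apply: cvgD => //; exact: cvg_cst.
(* [psum sigma n] is [T n.+1], and the role of [f] is played by the [alpha]-th power of [D], minimal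
   over [E] at [sigmahat]. *)
have /choice[q qP] : forall n, exists q, [/\ p (psum sigma n) = q%:E,
    q `^ gamma <= c n &
    D (psum sigma n) `^ alpha <= delta0 `^ alpha + a n * c n].
  rewrite -Dsh; apply: (argmin_iterates_le _ _ _ _ (fun s => D s `^ alpha)
    _ _ _ _ _ _ _ l0 a0 b0 g0 p0 pN pD _ am) => // s; exact: powR_ge0.
have q0 n : 0 <= q n by have [pq _ _] := qP n; rewrite -lee_fin -pq.
have Epsum n : E (psum sigma n).
  by have := (am n).1; rewrite /= /T /psum big_nat_recr.
have q_lt : forall e, 0 < e -> \forall n \near \oo, q n < h + e.
  by apply: (powR_near_ltD _ _ _ _ _ g0 h0 q0 _ rh_to0) => n; have [] := qP n.
have D_to : (fun n => D (psum sigma n)) @ \oo --> delta0.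
  apply: near_cvg_of_bounds => [|e e0].
    apply: (powR_near_ltD _ _ _ _ _ al0 d00 (fun=> D0 _) _ ac_to0) => n.
    by have [] := qP n.
  by near=> n; rewrite (lt_le_trans _ (d0D _ (Epsum n)))// ltrBlDr ltrDl.
(* All three conclusions follow from this one extraction. *)
have key phi : increasing_seq phi -> exists2 psi : nat -> nat,
    increasing_seq psi & exists x, [/\ psum sigma \o phi \o psi @ \oo --> x,
      Ehat x & q \o phi \o psi @ \oo --> h].
  move=> incr.
  (* Compactness needs every term in one sublevel set, so the first [M] terms are skipped; [psi]
     restores the shift. *)
  have [M _ qM] : \forall n \near \oo, q (phi n) < h + 1.
    exact: (increasing_seq_cvg _ incr) (q_lt _ ltr01).
  have [|psi' incr' [x cvx]] :=
      pcomp (h + 1) (fun n => psum sigma (phi (n + M)%N)).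
    move=> n /=; have [-> _ _] := qP (phi (n + M)%N).
    by rewrite lee_fin ltW// qM//= leq_addl.
  pose psi n := (psi' n + M)%N.
  have incrp : increasing_seq psi.
    by move=> m n; rewrite /psi leEnat leq_add2r -leEnat incr'.
  have cvpp : phi \o psi @ \oo --> \oo.
    exact: cvg_comp (increasing_seq_cvg _ incrp) (increasing_seq_cvg _ incr).
  have Ex : E x.
    by apply: (closed_cvg E cE _ x cvx); apply: nearW => n; exact: Epsum.
  have Dx : D x = delta0.
    (* Continuity of [D] holds only within [E], which contains all the partial sums and, being
       closed, [x]. *)
    have DD : (fun n => D (psum sigma (phi (psi n)))) @ \oo --> D x.
      have /subspace_continuousP/(_ x Ex) := cD.
      apply: (cvg_comp (psum sigma \o phi \o psi) D) => A /= wA.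
      by have [K _ KA] := cvx _ wA; exists K => // n /KA; apply; exact: Epsum.
    have DD' : (fun n => D (psum sigma (phi (psi n)))) @ \oo --> delta0.
      exact: cvg_comp cvpp D_to.
    exact: cvg_unique DD DD'.
  (* [x] is admissible for the constrained problem, so minimality of [sigmahat] applies; lower
     semicontinuity then bounds [q] from below along the subsequence. *)
  have hx : (h%:E <= p x)%E by rewrite -ph; exact: shmin.
  have qlo : forall e, 0 < e -> \forall n \near \oo, h - e < q (phi (psi n)).
    move=> e e0; have : ((h - e)%:E <
        limn_einf (p \o (psum sigma \o phi \o psi)))%E.
      apply: lt_le_trans (le_trans hx (plsc _ _ cvx)).
      by rewrite lte_fin ltrBlDr ltrDl.
    move=> /limn_einf_gt_near; apply: filterS => n /=.
    by have [-> _ _] := qP (phi (psi n)); rewrite lte_fin.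
  have qhi : forall e, 0 < e -> \forall n \near \oo, q (phi (psi n)) < h + e.
    by move=> e e0; exact: cvpp (q_lt e e0).
  have qh : (fun n => q (phi (psi n))) @ \oo --> h.
    exact: near_cvg_of_bounds.
  have pqE : p \o (psum sigma \o phi \o psi) = EFin \o (q \o phi \o psi).
    by apply/funext => n /=; have [-> _ _] := qP (phi (psi n)).
  (* A second use of lower semicontinuity: [q] now tends to [h], so [p x] cannot exceed [h]. *)
  have xh : (p x <= h%:E)%E.
    have [<- _] : (limn_einf (EFin \o (q \o phi \o psi)) = h%:E)
        * (limn_esup (EFin \o (q \o phi \o psi)) = h%:E).
      by apply: cvg_limn_einf_sup; apply: cvg_EFin; [exact: nearW | exact: qh].
    by rewrite -pqE; exact: plsc.
  exists psi => //; exists x; split=> //.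
  rewrite EhatE; split=> // y Ey; apply: (le_trans xh); rewrite -ph.
  exact: shmin.
split.
- have [|psi incr [x [cvx Ehx _]]] := key id; first by [].
  exists psi => //; exists x; move: (Ehx); rewrite EhatE => -[[Ex Dx] minx].
  by split=> //; apply/eqP; rewrite eq_le minx// shmin.
- have -> : p \o psum sigma = EFin \o q.
    by apply/funext => n /=; have [-> _ _] := qP n.
  rewrite ph; apply: cvg_EFin; first exact: nearW.
  apply: cvg_sub_subseq => phi /key[psi incr [x [_ _ qh]]].
  by exists psi.
- apply: cvg_sub_subseq => phi /key[psi incr [x [cvx Ehx _]]].
  exists psi => //.
  have cv0 : (fun n => `|psum sigma (phi (psi n)) - x|) @ \oo --> (0 : R).
    by apply/norm_cvg0P/subr_cvg0.
  (* The distance to [Ehat] lies between 0 and the distance to its element [x]. *)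
  apply: squeeze_cvgr (cvg_cst 0) cv0; apply: nearW => n /=.
  have lb0 : lbound [set `|psum sigma (phi (psi n)) - y| | y in Ehat] 0.
    by move=> _ [y _ <-].
  apply/andP; split; last by apply: ge_inf; [exists 0 | exists x].
  by apply: lb_le_inf => //; exists `|psum sigma (phi (psi n)) - x|, x.
Unshelve. all: end_near. Qed.
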